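(* Let $K$ be a field. The following two statements are equivalent. (A) (Ryser's conjecture) For every integer $r\ge2$ and every $r$-partite hypergraph $\mathcal H$ of rank $\le r$, one has $\tau(\mathcal H)\le(r-1)\nu(\mathcal H)$. (B) For every integer $r\ge2$, if $I$ is the edge ideal (over $K$) of an $r$-partite hypergraph of rank $\le r$, then $I^{((r-1)(k-1)+1)}\subseteq I^k$ for all integers $k\ge1$.
   Context: A hypergraph consists of a finite vertex set (here $\{1,\dots,n\}$ for some $n$) and a collection of nonempty subsets of it, called edges; all hypergraphs are assumed simple, i.e. no edge is properly contained in another. The rank is the maximum cardinality of an edge. A hypergraph is $r$-partite if its vertex set can be partitioned into $r$ parts such that no edge contains two vertices from the same part. $\nu(\mathcal H)$ is the maximum number of pairwise disjoint edges of $\mathcal H$, and $\tau(\mathcal H)$ is the minimum size of a cover, i.e. of a set of vertices meeting every edge. The edge ideal of a hypergraph $\mathcal H$ on $\{1,\dots,n\}$ is the squarefree monomial ideal of $K[x_1,\dots,x_n]$ generated by $\prod_{i\in F}x_i$ for edges $F$ of $\mathcal H$. $I^{(h)}$ is the $h$-th symbolic power; for a squarefree monomial ideal, $I^{(h)}=\bigcap_{P\in\mathrm{Min}(I)}P^h$, with $\mathrm{Min}(I)$ the set of minimal primes of $I$. *)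

(* Defs.v *)
From mathcomp Require Import all_boot all_order all_algebra.
From mathcomp Require Import boolp classical_sets.
From mathcomp Require Import mpoly.

Set Implicit Arguments.
Unset Strict Implicit.
Unset Printing Implicit Defensive.

Import GRing.Theory.

(* Sets of vertices and of edges are MathComp finite sets; ideals are
   mathcomp-classical sets, so that they need not be decidable. *)

Record hypergraph (n : nat) := Hypergraph {
  edges : {set {set 'I_n}};
  edges_neq0 : forall e, e \in edges -> e != finset.set0;
  edges_simple : forall e f, e \in edges -> f \in edges -> ~~ (e \proper f)
}.

Section Hypergraph.
Variables (n : nat) (H : hypergraph n).

Definition rank : nat := \max_(e in edges H) #|e|.

(* As usual for r-partite graphs, some of the parts may be empty. *)
Definition partite (r : nat) : Prop :=
  exists V : 'I_r -> {set 'I_n},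
    [/\ (forall v, exists i, v \in V i),
        (forall i j, i != j -> [disjoint V i & V j]) &
        (forall e i, e \in edges H -> #|e :&: V i| <= 1)].

Definition matching (M : {set {set 'I_n}}) : bool :=
  (M \subset edges H) && finset.trivIset M.

Definition nu : nat := \max_(M : {set {set 'I_n}} | matching M) #|M|.

Definition vertex_cover (C : {set 'I_n}) : bool :=
  [forall e in edges H, e :&: C != finset.set0].

(* The whole vertex set is a cover because edges are nonempty. *)
Lemma vertex_coverT : vertex_cover [set: 'I_n].
Proof. by apply/forall_inP => e He; rewrite finset.setIT; apply: edges_neq0 He. Qed.

Definition tau : nat :=
  #|[arg min_(C < [set: 'I_n]%SET | vertex_cover C) #|C| ]|.

End Hypergraph.

Local Open Scope classical_set_scope.
Local Open Scope ring_scope.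

Section Ideals.
Variable R : comNzRingType.
Implicit Types (S I P Q : set R).

Definition ideal_gen S : set R :=
  [set x | exists2 s : seq (R * R),
     (forall p, p \in s -> S p.2) & x = \sum_(p <- s) p.1 * p.2].

Definition ideal_pow I (k : nat) : set R :=
  ideal_gen [set x | exists2 g : 'I_k -> R,
     (forall i, I (g i)) & x = \prod_(i < k) g i].

(* [idealr_closed] includes properness. *)
Definition prime_ideal P : Prop :=
  idealr_closed (mem P) /\ prime_idealr_closed (mem P).

Definition min_primes I : set (set R) :=
  [set P | [/\ prime_ideal P, I `<=` P &
     forall Q, prime_ideal Q -> I `<=` Q -> Q `<=` P -> Q = P]].

(* The symbolic power of a squarefree monomial ideal; this formula is not the
   right notion for an arbitrary ideal. *)
Definition symbolic_pow I (h : nat) : set R :=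
  \bigcap_(P in min_primes I) ideal_pow P h.

End Ideals.

Definition edge_ideal (K : fieldType) (n : nat) (H : hypergraph n) :
    set {mpoly K[n]} :=
  ideal_gen [set m | exists2 F : {set 'I_n},
     F \in edges H & m = \prod_(i in F) 'X_i].
Arguments edge_ideal K {n} H.

(* Main.v *)
(* A monomial x^a lies in I^k iff k edges, counted with repetition, use each
   vertex i at most a_i times, and a polynomial in the symbolic power I^(h)
   involves only monomials x^a whose degree in the variables of every cover is
   at least h.

   (A) => (B): replacing each vertex i by a_i copies preserves r-partiteness and
   rank. A cover of the new hypergraph contains all the copies of the vertices of
   some cover of the old one, so the covering number is at least h, Ryser's
   bound gives a matching of size k, and this matching projects to k edges whose
   product divides x^a.

   (B) => (A): every prime containing I contains the variables of some cover, so
   x_1 ... x_n is in I^(tau). If tau > (r-1) nu, then (B) with k = nu + 1 puts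
   this squarefree monomial in I^k, which yields nu + 1 disjoint edges. *)

Require Import Defs.
From mathcomp Require Import all_boot all_order all_algebra.
From mathcomp Require Import boolp classical_sets.
From mathcomp Require Import mpoly.
From mathcomp Require Import zify.

Set Implicit Arguments.
Unset Strict Implicit.
Unset Printing Implicit Defensive.

Import GRing.Theory.

(** * Matching number, covering number and minimal covers *)

Lemma nu_ge n (H : hypergraph n) (M : {set {set 'I_n}}) :
  matching H M -> #|M| <= nu H.
Proof. exact: (@leq_bigmax_cond _ (matching H) (fun M => #|M|)). Qed.

Lemma nu_attained n (H : hypergraph n) :
  exists2 M : {set {set 'I_n}}, matching H M & #|M| = nu H.
Proof.
have H0 : matching H finset.set0.
  rewrite /matching finset.sub0set; apply/finset.trivIsetP => A B.
  by rewrite finset.in_set0.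
have [|M HM e] := @eq_bigmax_cond _ (matching H) (fun M => #|M|).
  by apply/card_gt0P; exists finset.set0.
by exists M => //; apply: esym e.
Qed.

Lemma tau_le n (H : hypergraph n) (C : {set 'I_n}) :
  vertex_cover H C -> tau H <= #|C|.
Proof.
rewrite /tau; case: arg_minnP => [|D _ min_D /min_D //].
exact: vertex_coverT.
Qed.

Lemma tau_attained n (H : hypergraph n) :
  exists2 C : {set 'I_n}, vertex_cover H C & #|C| = tau H.
Proof.
rewrite /tau; case: arg_minnP => [|D cov_D _]; first exact: vertex_coverT.
by exists D.
Qed.

(** An edge listed twice would count twice at any of its vertices, and it has one since edges are
    nonempty; two distinct edges sharing a vertex would both count there. *)
Lemma count_le1_matching n (H : hypergraph n) (s : seq {set 'I_n}) :
  {subset s <= edges H} ->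
  (forall i, count (fun e : {set 'I_n} => i \in e) s <= 1) ->
  matching H [set e in s] /\ #|[set e in s]| = size s.
Proof.
move=> sH s1.
have us : uniq s.
  apply: count_mem_uniq => e; case: (boolP (e \in s)) => es; last exact/count_memPn.
  have /set0Pn [i ie] := edges_neq0 (sH e es).
  apply/eqP; rewrite eqn_leq -has_count has_pred1 es andbT.
  by apply: leq_trans (s1 i); apply: sub_count => _ /eqP ->.
split; last by rewrite cardsE; apply/card_uniqP.
apply/andP; split; first by apply/fintype.subsetP => e; rewrite inE => /sH.
apply/finset.trivIsetP => e f; rewrite !inE => es fs nef.
apply/pred0P => i /=; apply/negP => /andP [ie jf].
have : size [:: e; f] <= size [seq g : {set 'I_n} <- s | i \in g].
  apply: uniq_leq_size; first by rewrite /= inE nef.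
  by move=> g; rewrite !inE mem_filter => /orP [] /eqP ->; rewrite ?ie ?jf.
by rewrite size_filter leqNgt ltnS s1.
Qed.

Lemma minimal_cover n (H : hypergraph n) (C : {set 'I_n}) :
  vertex_cover H C ->
  exists2 D, minset (vertex_cover H) D & D \subset C.
Proof. by case/minset_exists => D *; exists D. Qed.

(** * Blowing up the vertices of a hypergraph *)

Section BlowUp.
(* Vertex i of [H] is replaced by the fibre of [p] over i. *)
Variables (n N : nat) (H : hypergraph n) (p : 'I_N -> 'I_n).

(** Equality of cardinals says that [p] is injective on [e]: an edge picks exactly one copy of each
    vertex of an edge of [H]. *)
Definition blowup_edges : {set {set 'I_N}} :=
  [set e : {set 'I_N} | (p @: e \in edges H) && (#|p @: e| == #|e|)].

Lemma blowup_edges_neq0 e : e \in blowup_edges -> e != finset.set0.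
Proof.
rewrite inE => /andP [pe _]; apply: contraTneq pe => ->.
by rewrite imset0; apply/negP => /edges_neq0; rewrite eqxx.
Qed.

Lemma blowup_edges_simple e f :
  e \in blowup_edges -> f \in blowup_edges -> ~~ (e \proper f).
Proof.
rewrite !inE => /andP [pe /eqP ce] /andP [pf /eqP cf].
apply/negP => lt_ef; have /negP := edges_simple pe pf; apply.
rewrite properEcard imsetS ?proper_sub //= ce cf.
exact: proper_card.
Qed.

Definition blowup : hypergraph N :=
  Hypergraph blowup_edges_neq0 blowup_edges_simple.

Lemma blowup_partite r : partite H r -> partite blowup r.
Proof.
case=> V [covV disV eV]; exists (fun i => p @^-1: V i); split.
- by move=> v; have [i vi] := covV (p v); exists i; rewrite inE.
- move=> i j /disV; rewrite -!setI_eq0 => /eqP dV.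
  by rewrite -preimsetI dV preimset0.
move=> e i; rewrite inE => /andP [pe /imset_injP inj_p].
have /card_in_imset <- : {in e :&: p @^-1: V i &, injective p}.
  by move=> x y; rewrite !finset.in_setI => /andP [? _] /andP [? _]; apply: inj_p.
apply: leq_trans (eV _ i pe); apply: subset_leq_card.
apply/fintype.subsetP => _ /imsetP [x xe ->]; move: xe.
by rewrite !inE => /andP [xe ->]; rewrite imset_f.
Qed.

Lemma blowup_rank : rank blowup <= rank H.
Proof.
apply/bigmax_leqP => e; rewrite inE => /andP [pe /eqP <-].
exact: (@leq_bigmax_cond _ (fun e => e \in edges H) (fun e : {set 'I_n} => #|e|)).
Qed.

(** Vertices with an empty fibre are included, rightly so: no edge of the blow-up lies over an edge
    of [H] through such a vertex. *)
Definition full_fibres (C : {set 'I_N}) : {set 'I_n} :=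
  [set i | p @^-1: [set i] \subset C].

(** If every vertex of an edge [e] of [H] had a copy outside [C], these copies would form an edge of
    the blow-up that [C] misses. *)
Lemma full_fibres_cover C : vertex_cover blowup C -> vertex_cover H (full_fibres C).
Proof.
move=> /forall_inP covC; apply/forall_inP => e eH; apply/negP => /eqP eC.
have missed i : i \in e -> exists x, (p x == i) && (x \notin C).
  move=> ie; have : i \notin full_fibres C.
    by apply: contra_eqN eC => iC; apply/set0Pn; exists i; rewrite finset.in_setI ie.
  by rewrite inE => /subsetPn [x]; rewrite !inE => px xC; exists x; rewrite px.
have [v Pv] : exists v : 'I_n -> 'I_N,
    forall i, i \in e -> (p (v i) == i) && (v i \notin C).
  apply: (@fin_all_exists _ (fun=> 'I_N)
    (fun i x => i \in e -> (p x == i) && (x \notin C))) => i.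
  case: (boolP (i \in e)) => [/missed [x]|_]; first by exists x.
  (* Outside [e] the choice is arbitrary, but ['I_N] needs an element: a copy of some vertex of [e]
     serves. *)
  by have /set0Pn [j /missed [x _]] := edges_neq0 eH; exists x.
have pve : p @: (v @: e) = e.
  rewrite -imset_comp -[RHS]finset.imset_id; apply: eq_in_imset => i /Pv /andP [/eqP] //.
have ve : v @: e \in edges blowup.
  rewrite inE pve eH /= card_in_imset //.
  move=> i j /Pv /andP [/eqP pi _] /Pv /andP [/eqP pj _].
  by move=> /(congr1 p); rewrite pi pj.
have /set0Pn [x] := covC _ ve.
by rewrite inE => /andP [/imsetP [i /Pv /andP [_ /negP vC] ->]].
Qed.

Lemma card_full_fibres C :
  \sum_(i in full_fibres C) #|p @^-1: [set i]| <= #|C|.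
Proof.
rewrite -[leqRHS]sum1_card (partition_big p predT) //=.
rewrite [leqLHS]big_mkcond /=; apply: leq_sum => i _; case: ifP => //.
rewrite inE => /fintype.subsetP iC; rewrite -sum1_card; apply/eq_leq/eq_bigl => x.
rewrite !inE; apply/idP/andP => [px|[] //]; split => //.
by apply: iC; rewrite !inE.
Qed.

(** The edges of [M] that project onto an edge through [i] meet the fibre over [i] in distinct
    points, being disjoint. *)
Lemma blowup_matching (M : {set {set 'I_N}}) i : matching blowup M ->
  \sum_(e in M) (i \in p @: e) <= #|p @^-1: [set i]|.
Proof.
case/andP => _ tM.
have -> : #|p @^-1: [set i]| = \sum_(x | p x == i) 1.
  by rewrite -sum1_card; apply: eq_bigl => x; rewrite !inE.
apply: (@leq_trans (\sum_(x in finset.cover M | p x == i) 1)); last first.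
  rewrite big_mkcondl /=; apply: leq_sum => x _; by case: ifP.
rewrite big_trivIset_cond //=; apply: leq_sum => e _.
case: imsetP => //= -[x xe ->]; rewrite (bigD1 x) //= ?xe ?eqxx //.
Qed.

End BlowUp.

(** The map is the first projection of the disjoint union of the ['I_(a i)], read through an
    enumeration of that union. *)
Lemma fibres_exist n (a : 'I_n -> nat) :
  exists N, exists p : 'I_N -> 'I_n, forall i, #|p @^-1: [set i]| = a i.
Proof.
pose T := {i : 'I_n & 'I_(a i)}.
exists #|{: T}|, (fun v => tag (enum_val v)) => i.
rewrite -sum1_card (eq_bigl (fun v => tag (enum_val v) == i)); last first.
  by move=> v; rewrite !inE.
rewrite (reindex (@enum_rank T)) /=; last exact/onW_bij/enum_rank_bij.
(* The trivial conjunct gives the sum the shape expected by [sig_big_dep]. *)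
rewrite (eq_bigl (fun x : T => (tag x == i) && true)); last first.
  by move=> x; rewrite enum_rankK andbT.
rewrite -(@sig_big_dep _ _ addn _ (fun j => 'I_(a j)) (pred1 i)
  (fun _ _ => true) (fun _ _ => 1)).
by rewrite big_pred1_eq sum1_card card_ord.
Qed.

Lemma blowup_packing n (H : hypergraph n) (a : 'I_n -> nat) (r k : nat) :
  (forall N (H' : hypergraph N), partite H' r -> rank H' <= r ->
     tau H' <= (r - 1) * nu H') ->
  partite H r -> rank H <= r ->
  (forall C, vertex_cover H C -> (r - 1) * (k - 1) < \sum_(i in C) a i) ->
  exists s : seq {set 'I_n},
    [/\ size s = k, {subset s <= edges H} &
        forall i, count (fun e : {set 'I_n} => i \in e) s <= a i].
Proof.
move=> ryser partH rkH coverH.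
have [N [p pa]] := fibres_exist a.
have := ryser _ _ (blowup_partite p partH) (leq_trans (blowup_rank H p) rkH).
have [C covC <-] := tau_attained (blowup H p).
have [M MH <-] := nu_attained (blowup H p) => leCM.
(* The full fibres of [C] give (r-1)(k-1) < |C|, and |C| <= (r-1)|M|; hence k-1 < |M|. *)
have kM : k <= #|M|.
  have := coverH _ (full_fibres_cover covC).
  under eq_bigr do rewrite -pa.
  move/leq_trans/(_ (card_full_fibres p C))/leq_trans/(_ leCM).
  by rewrite ltn_mul2l; lia.
(* Distinct edges of [M] may have the same image, so the images are kept as a list with repetitions,
   cut to length [k]. *)
exists (take k [seq p @: e | e : {set 'I_N} <- enum M]); split.
- by rewrite size_takel // size_map -cardE.
- move=> e /mem_take /mapP [f]; rewrite mem_enum => fM ->.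
  case/andP: MH => /fintype.subsetP /(_ _ fM).
  by rewrite inE => /andP [].
move=> i; rewrite -pa; apply: leq_trans (blowup_matching i MH).
apply: (@leq_trans (count (fun e : {set 'I_n} => i \in e)
                          [seq p @: e | e : {set 'I_N} <- enum M])).
  by rewrite -[X in _ <= count _ X](cat_take_drop k) count_cat leq_addr.
by rewrite count_map -sum1_count big_enum_cond big_mkcondr /=.
Qed.

Local Open Scope classical_set_scope.
Local Open Scope ring_scope.

(** * Generated ideals, their powers, and primes *)

Section IdealGen.
Variable R : comNzRingType.
Implicit Types (S I J : set R) (x y : R).

Lemma mem_ideal_gen S x : S x -> ideal_gen S x.
Proof.
move=> Sx; exists [:: (1, x)]; last by rewrite big_seq1 mul1r.
by move=> p; rewrite mem_seq1 => /eqP ->.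
Qed.

Lemma ideal_gen_min S J :
  J 0 -> (forall x y, J x -> J y -> J (x + y)) -> (forall x y, J y -> J (x * y)) ->
  S `<=` J -> ideal_gen S `<=` J.
Proof.
move=> J0 JD JM SJ _ [s Ss ->]; rewrite big_seq; apply: big_ind => // p ps.
by apply/JM/SJ/Ss.
Qed.

Lemma ideal_gen0 S : ideal_gen S 0.
Proof. by exists [::]; rewrite ?big_nil. Qed.

Lemma ideal_genD S x y : ideal_gen S x -> ideal_gen S y -> ideal_gen S (x + y).
Proof.
case=> s Ss -> [t St ->]; exists (s ++ t); last by rewrite big_cat.
by move=> p; rewrite mem_cat => /orP [/Ss | /St].
Qed.

Lemma ideal_genM S x y : ideal_gen S y -> ideal_gen S (x * y).
Proof.
case=> s Ss ->; exists [seq (x * p.1, p.2) | p <- s].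
  by move=> _ /mapP [p /Ss Sp ->].
by rewrite big_map big_distrr /=; apply: eq_bigr => p _; rewrite mulrA.
Qed.

(** The first [k] factors form a generator of the power and the remaining ones its coefficient. *)
Lemma prod_mem_ideal_pow I k (s : seq R) :
  (k <= size s)%N -> (forall x, x \in s -> I x) -> ideal_pow I k (\prod_(x <- s) x).
Proof.
move=> ks sI; rewrite -(cat_take_drop k s) big_cat /= mulrC.
apply/ideal_genM/mem_ideal_gen; exists (fun i : 'I_k => s`_i).
  by move=> i; apply/sI/mem_nth/(leq_trans (ltn_ord i)).
rewrite (big_nth 0) size_takel // big_mkord.
by apply: eq_bigr => i _; rewrite nth_take.
Qed.

Lemma prime_ideal_prod P (T : finType) (A : {set T}) (F : T -> R) :
  prime_ideal P -> P (\prod_(i in A) F i) -> exists2 i, i \in A & P (F i).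
Proof.
case=> -[_ P1 _] Pp; rewrite -big_enum.
have : {subset enum A <= A} by move=> i; rewrite mem_enum.
elim: (enum A) => [|i s IH] sA.
  by rewrite big_nil => /mem_set; rewrite (negPf P1).
rewrite big_cons => /mem_set /Pp /orP [] /set_mem Pi.
  by exists i => //; apply: sA; rewrite mem_head.
by apply: IH => // j js; apply: sA; rewrite in_cons js orbT.
Qed.

End IdealGen.

(** * Ideals described by the monomials in the support *)

Section Support.
Variables (K : fieldType) (n : nat).
Implicit Types (f g : {mpoly K[n]}) (m : 'X_{1..n}).

(** When [T] is stable under multiplication by monomials, this is the monomial ideal spanned by the
    monomials in [T]. *)
Definition supported (T : 'X_{1..n} -> Prop) : set {mpoly K[n]} :=
  [set f | forall m, m \in msupp f -> T m].

Lemma supportedX (T : 'X_{1..n} -> Prop) m : T m -> supported T 'X_[m].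
Proof. by move=> Tm m'; rewrite msuppX mem_seq1 => /eqP ->. Qed.

Lemma supported0 T : supported T 0.
Proof. by move=> m; rewrite msupp0. Qed.

Lemma supportedD T f g : supported T f -> supported T g -> supported T (f + g).
Proof. by move=> Tf Tg m /msuppD_le; rewrite mem_cat => /orP [/Tf | /Tg]. Qed.

Lemma supportedM (T1 T2 T3 : 'X_{1..n} -> Prop) f g :
  (forall m1 m2, T1 m1 -> T2 m2 -> T3 (m1 + m2)%MM) ->
  supported T1 f -> supported T2 g -> supported T3 (f * g).
Proof.
move=> T123 Tf Tg m /msuppM_le /allpairsP [[m1 m2] [/Tf T1m /Tg T2m ->]].
exact: T123.
Qed.

Lemma supported_ideal_gen T S :
  (forall m1 m2, T m2 -> T (m1 + m2)%MM) ->
  S `<=` supported T -> ideal_gen S `<=` supported T.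
Proof.
move=> Tup; apply: ideal_gen_min; first exact: supported0.
  by move=> x y; apply: supportedD.
by move=> x y; apply: (@supportedM (fun=> True)) => // m1 m2 _; apply: Tup.
Qed.

(** Here [T j] is a monomial condition for the [j]-th power. It serves both for packings of [j]
    edges and for degree at least [j] in the variables of a cover. *)
Lemma supported_ideal_pow (T : nat -> 'X_{1..n} -> Prop) I k :
  (forall m, T 0%N m) ->
  (forall j m1 m2, T j m2 -> T j (m1 + m2)%MM) ->
  (forall j m1 m2, T 1%N m1 -> T j m2 -> T j.+1 (m1 + m2)%MM) ->
  I `<=` supported (T 1%N) -> ideal_pow I k `<=` supported (T k).
Proof.
move=> T0 Tup TS IT; apply: supported_ideal_gen; first exact: Tup.
move=> _ [g Ig ->]; elim: k g Ig => [|k IH] g Ig.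
  by move=> m _; apply: T0.
rewrite big_ord_recl; apply: supportedM (TS k) (IT _ (Ig _)) _.
by apply: IH => i; apply: Ig.
Qed.

Lemma ideal_gen_supported (S : set {mpoly K[n]}) f :
  supported (fun m => ideal_gen S 'X_[m]) f -> ideal_gen S f.
Proof.
move=> Sf; rewrite (mpolyE f) big_seq; apply: big_ind => [|x y|m /Sf Sm].
- exact: ideal_gen0.
- exact: ideal_genD.
- by rewrite -mul_mpolyC; apply: ideal_genM.
Qed.

End Support.

(** * Powers, minimal primes and symbolic powers of the edge ideal *)

Section EdgeIdeal.
Variables (K : fieldType) (n : nat) (H : hypergraph n).
Implicit Types (m : 'X_{1..n}) (C : {set 'I_n}).

Definition packing k m : Prop :=
  exists s : seq {set 'I_n},
    [/\ size s = k, {subset s <= edges H} &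
        forall i, (count (fun e : {set 'I_n} => i \in e) s <= m i)%N].

Lemma prod_mesym1 (F : {set 'I_n}) : \prod_(i in F) 'X_i = 'X_[mesym1 F] :> {mpoly K[n]}.
Proof.
rewrite mprodXE; congr 'X_[_]; apply/mnmP => i; rewrite mnm_sumE mnmE.
rewrite big_mkcond (bigD1 i) //= big1 ?addn0 => [|j /negPf ji].
  by rewrite mnm1E eqxx; case: ifP.
by rewrite mnm1E ji; case: ifP.
Qed.

Lemma edge_ideal_powP k : ideal_pow (edge_ideal K H) k `<=` supported (packing k).
Proof.
have up j m1 m2 : packing j m2 -> packing j (m1 + m2)%MM.
  case=> s [ss sH sm]; exists s; split => // i.
  by rewrite mnmDE; apply: leq_trans (sm i) (leq_addl _ _).
apply: supported_ideal_pow (up) _ _ => [m|j m1 m2|]; first by exists [::].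
  (* A packing of size one is a single edge [e], to be put in front of the other list. *)
  case=> -[|e [|e' t]] [] //= _ eH em [s [ss sH sm]]; exists (e :: s); split.
  - by rewrite /= ss.
  - by move=> f; rewrite in_cons => /orP [/eqP ->|/sH //]; apply: eH; rewrite mem_head.
  - by move=> i; rewrite /= mnmDE leq_add // -[X in (X <= _)%N]addn0.
apply: supported_ideal_gen => [m1 m2|_ [F FH ->]]; first exact: up.
rewrite prod_mesym1; apply: supportedX; exists [:: F]; split => //.
  by move=> e; rewrite mem_seq1 => /eqP ->.
by move=> i; rewrite mnmE /= addn0.
Qed.

(** The counting condition says that the product of the edge monomials divides ['X_[m]]. *)
Lemma packing_edge_ideal k m : packing k m -> ideal_pow (edge_ideal K H) k 'X_[m].
Proof.
case=> s [ss sH sm].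
have les : (\sum_(e <- s) mesym1 e <= m)%MM.
  apply/mnm_lepP => i; rewrite mnm_sumE; apply: leq_trans (sm i).
  rewrite -sum1_count [leqRHS]big_mkcond /=; apply: leq_sum => e _.
  by rewrite mnmE; case: (i \in e).
rewrite -(submK les) mpolyXD -mprodXE; apply: ideal_genM.
rewrite -(big_map (fun e => 'X_[mesym1 e]) predT id); apply: prod_mem_ideal_pow.
  by rewrite size_map ss.
move=> _ /mapP [e /sH eH ->]; apply: mem_ideal_gen; exists e => //.
by rewrite prod_mesym1.
Qed.

Definition variables_in (P : set {mpoly K[n]}) : {set 'I_n} :=
  [set i | `[< P 'X_i >]].

(** A prime containing the monomial of an edge contains one of its variables. *)
Lemma variables_in_cover P :
  prime_ideal P -> edge_ideal K H `<=` P -> vertex_cover H (variables_in P).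
Proof.
move=> Pp HP; apply/forall_inP => e eH; apply/set0Pn.
have [|i ie Pi] := prime_ideal_prod (A := e) (F := fun i => 'X_i) Pp.
  by apply/HP/mem_ideal_gen; exists e.
by exists i; rewrite finset.in_setI ie inE; apply/asboolP.
Qed.

Definition cover_deg C m : nat := (\sum_(i in C) m i)%N.

Lemma cover_degD C m1 m2 : cover_deg C (m1 + m2)%MM = (cover_deg C m1 + cover_deg C m2)%N.
Proof. by rewrite /cover_deg -big_split; apply: eq_bigr => i _; rewrite mnmDE. Qed.

Lemma cover_deg_gt0P C m : reflect (exists2 i, i \in C & 0 < m i)%N (0 < cover_deg C m)%N.
Proof.
rewrite lt0n sum_nat_eq0 negb_forall_in.
by apply: (iffP exists_inP) => -[i iC mi]; exists i => //; rewrite lt0n in mi *.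
Qed.

(** This is the ideal generated by the variables of [C], given through supports so that membership
    can be tested on monomials. *)
Definition cover_prime C : set {mpoly K[n]} := supported (fun m => 0 < cover_deg C m)%N.

(* Its kernel is [cover_prime C], which is therefore prime. *)
Definition vanish C (f : {mpoly K[n]}) : {mpoly K[n]} :=
  f \mPo [tuple if i \in C then 0 else 'X_i | i < n].

Lemma vanishX C m : vanish C 'X_[m] = if (0 < cover_deg C m)%N then 0 else 'X_[m].
Proof.
rewrite /vanish comp_mpolyX; case: cover_deg_gt0P => [[i iC mi]|mC].
  by rewrite (bigD1 i) //= tnth_mktuple iC expr0n eqn0Ngt mi mul0r.
rewrite [RHS]mpolyXE_id; apply: eq_bigr => i _; rewrite tnth_mktuple.
case: ifP => // iC; case: (posnP (m i)) => [->|mi]; first by rewrite !expr0.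
by case: mC; exists i.
Qed.

Lemma vanishE C f : vanish C f = \sum_(m <- msupp f | cover_deg C m == 0%N) f@_m *: 'X_[m].
Proof.
rewrite {1}(mpolyE f) /vanish raddf_sum [RHS]big_mkcond; apply: eq_bigr => m _.
rewrite /= comp_mpolyZ -/(vanish C _) vanishX lt0n; case: ifP => /= [/negPf ->|/negbFE ->] //.
exact: scaler0.
Qed.

(** [vanish C] keeps exactly the terms free of the variables of [C]; such a term of [f] would
    survive with its nonzero coefficient. *)
Lemma cover_primeP C f : cover_prime C f <-> vanish C f = 0.
Proof.
rewrite vanishE; split=> [Cf|f0 m mf].
  by rewrite big_seq_cond big1 // => m /andP [/Cf]; rewrite lt0n => /negPf ->.
rewrite lt0n; apply/eqP => Cm; move: mf; rewrite mcoeff_msupp.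
have := congr1 (mcoeff m) f0; rewrite mcoeff0 raddf_sum /=.
case: (boolP (m \in msupp f)) => [mf|/memN_msupp_eq0 -> _]; last by rewrite eqxx.
rewrite (big_rem m) //= Cm eqxx mcoeffZ mcoeffX eqxx mulr1 big_seq_cond big1 => [|m'].
  by rewrite addr0 => ->; rewrite eqxx.
rewrite mem_rem_uniq ?msupp_uniq // => /andP []; rewrite !inE => /andP [/negPf m'm _] _.
by rewrite mcoeffZ mcoeffX m'm mulr0.
Qed.

Lemma cover_prime_prime C : prime_ideal (cover_prime C).
Proof.
have inP f : reflect (vanish C f = 0) (f \in mem (cover_prime C)).
  apply: (iffP idP) => [/set_mem/cover_primeP //|]; by move/cover_primeP/mem_set.
split; first split.
- by apply/inP; rewrite /vanish raddf0.
- by apply/inP; rewrite /vanish rmorph1; apply/eqP/oner_neq0.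
- move=> a u v /inP u0 /inP v0; apply/inP.
  by rewrite /vanish rmorphD rmorphM /= -!/(vanish _ _) u0 v0 mulr0 addr0.
move=> u v /inP; rewrite /vanish rmorphM /= -!/(vanish _ _) => /eqP; rewrite mulf_eq0.
by case/orP => /eqP /inP ->; rewrite ?orbT.
Qed.

(** Each monomial of a member of [cover_prime C] is divisible by a variable of [C], and that
    variable lies in [P]. *)
Lemma cover_prime_min C (P : set {mpoly K[n]}) :
  prime_ideal P -> C \subset variables_in P -> cover_prime C `<=` P.
Proof.
move=> -[[/set_mem P0 _ PDM] _] /fintype.subsetP CP f Cf.
(* [idealr_closed] offers closure under a u + v only; sums come from a = 1 and multiples from v =
   0. *)
have PD x y : P x -> P y -> P (x + y).
  move=> /mem_set Px /mem_set Py; apply: set_mem.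
  by rewrite -[x]mul1r; apply: PDM.
have PM x y : P y -> P (x * y).
  move=> /mem_set Py; apply: set_mem; rewrite -[_ * _]addr0; apply: PDM => //.
  exact: mem_set.
rewrite (mpolyE f) big_seq; apply: big_ind => // m /Cf /cover_deg_gt0P [i /CP].
rewrite inE => /asboolP Pi mi; have mi' : (U_(i) <= m)%MM.
  by apply/mnm_lepP => j; rewrite mnm1E; case: eqP => [<-|].
by rewrite -(submK mi') mpolyXD -mul_mpolyC mulrA; apply: PM.
Qed.

Lemma variables_in_cover_prime C : variables_in (cover_prime C) = C.
Proof.
apply/setP => i; rewrite inE; apply/asboolP/idP => [/(_ U_(i)%MM)|iC].
  rewrite msuppX mem_head => /(_ isT) /cover_deg_gt0P [j jC].
  by rewrite mnm1E; case: eqP => // ->.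
by apply: supportedX; apply/cover_deg_gt0P; exists i => //; rewrite mnm1E eqxx.
Qed.

(** The variables in a prime [Q] between the edge ideal and [cover_prime C] form a cover inside [C],
    so all of [C] by minimality; then [Q] contains [cover_prime C]. *)
Lemma cover_prime_min_primes C :
  minset (vertex_cover H) C -> min_primes (edge_ideal K H) (cover_prime C).
Proof.
move=> /minsetP [covC minC]; split; first exact: cover_prime_prime.
  apply: supported_ideal_gen => [m1 m2|_ [F FH ->]].
    by rewrite cover_degD => /leq_trans -> //; rewrite leq_addl.
  rewrite prod_mesym1; apply: supportedX.
  have /set0Pn [i] := forall_inP covC F FH; rewrite finset.in_setI => /andP [iF iC].
  by apply/cover_deg_gt0P; exists i => //; rewrite mnmE iF.
move=> Q Qp HQ QC; apply/seteqP; split => //; apply: cover_prime_min => //.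
rewrite (minC (variables_in Q)) //; first exact: variables_in_cover.
rewrite -(variables_in_cover_prime C); apply/fintype.subsetP => i.
by rewrite !inE => /QC.
Qed.

Lemma symbolic_pow_cover_deg h C :
  minset (vertex_cover H) C ->
  symbolic_pow (edge_ideal K H) h `<=` supported (fun m => h <= cover_deg C m)%N.
Proof.
move=> minC f /(_ _ (cover_prime_min_primes minC)).
apply: (supported_ideal_pow (T := fun j m => (j <= cover_deg C m)%N)) =>
  [//|j m1 m2|j m1 m2|//].
  by rewrite cover_degD => /leq_trans -> //; rewrite leq_addl.
by rewrite cover_degD -add1n; apply: leq_add.
Qed.

(** The variables in [P] form a cover, so at least [h] factors lie in [P]; the other variables act
    as a coefficient. *)
Lemma prod_variables_symbolic_pow h :
  (h <= tau H)%N -> symbolic_pow (edge_ideal K H) h (\prod_i 'X_i).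
Proof.
move=> hH P [Pp HP _]; set C := variables_in P.
have hC : (h <= #|C|)%N := leq_trans hH (tau_le (variables_in_cover Pp HP)).
rewrite (bigID (mem C)) /= mulrC; apply: ideal_genM.
rewrite -big_enum -(big_map (fun i => 'X_i) predT id); apply: prod_mem_ideal_pow.
  by rewrite size_map -cardE.
by move=> x /mapP [i]; rewrite mem_enum !inE => Pi ->.
Qed.

End EdgeIdeal.

Theorem theorem4p9 (K : fieldType) :
  (forall (r n : nat) (H : hypergraph n),
     (2 <= r)%N -> partite H r -> (rank H <= r)%N ->
     (tau H <= (r - 1) * nu H)%N)
  <->
  (forall (r n : nat) (H : hypergraph n),
     (2 <= r)%N -> partite H r -> (rank H <= r)%N ->
     forall k : nat, (1 <= k)%N ->
       symbolic_pow (edge_ideal K H) ((r - 1) * (k - 1) + 1)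
         `<=` ideal_pow (edge_ideal K H) k).
Proof.
split=> [ryser r n H r2 partH rkH k k1 f symf|sym r n H r2 partH rkH].
  apply: ideal_gen_supported => m mf; apply: packing_edge_ideal.
  apply: (@blowup_packing _ H (fun i => m i) r k) => //; last first.
    (* The degree bound is known for minimal covers; it passes to [C], whose sum has more terms. *)
    move=> C /minimal_cover [D minD /fintype.subsetP DC].
    have := symbolic_pow_cover_deg minD symf mf.
    rewrite addn1 => /leq_trans -> //; rewrite /cover_deg.
    rewrite [leqLHS]big_mkcond [leqRHS]big_mkcond /=; apply: leq_sum => i _.
    by case: ifP => // /DC ->.
  by move=> N H' ? ?; apply: ryser.
rewrite leqNgt; apply/negP => lt_tau.
have /(sym r n H r2 partH rkH (nu H).+1 isT)/edge_ideal_powP : 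
    symbolic_pow (edge_ideal K H) ((r - 1) * ((nu H).+1 - 1) + 1) (\prod_i 'X_i).
  (* With k = nu + 1 the exponent is (r-1) nu + 1, which is at most tau by [lt_tau]. *)
  by apply: prod_variables_symbolic_pow; rewrite subSS subn0 addn1.
have -> : \prod_i 'X_i = 'X_[mesym1 [set: 'I_n]%SET] :> {mpoly K[n]}.
  by rewrite -prod_mesym1; apply: eq_bigl => i; rewrite finset.in_setT.
move=> /(_ (mesym1 [set: 'I_n]%SET)); rewrite msuppX mem_head.
move=> /(_ isT) [s [ss sH s1]].
(* All exponents are 1, so the nu + 1 packed edges are pairwise disjoint, too many for a
   matching. *)
have [|/nu_ge] := count_le1_matching sH.
  by move=> i; have := s1 i; rewrite mnmE finset.in_setT.
by move=> + e; rewrite e ss ltnn.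
Qed.
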